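(* Let $K_1,K_2\subset\mathbb{R}^d$ be compact sets forming a packing pair, i.e. $(K_1-K_1)\cap(K_2-K_2)=\{0\}$, and let $\nu,\lambda$ be nonzero finite Borel measures on $\mathbb{R}^d$ without atoms, supported on $K_1$ and $K_2$ respectively. Let $\mu=\nu\ast\lambda$. Then for every $t\in\mathbb{R}^d$ the measure $$\rho_t=\mu+\delta_t\ast\nu$$ is translationally singular and does not admit any Fourier frame.
   Context: All measures are (positive) Borel measures on $\mathbb{R}^d$. For sets, $A-A=\{a-a':a,a'\in A\}$. Convolution: $\nu\ast\lambda(E)=\int\int \mathbf{1}_E(x+y)\,d\nu(x)\,d\lambda(y)$; in particular $\delta_t\ast\nu(E)=\nu(E-t)$. Fourier frame: a finite Borel measure $\rho$ admits a Fourier frame if there is a countable set $\Lambda\subset\mathbb{R}^d$ and constants $0<A\le B<\infty$ with $A\|f\|_{L^2(\rho)}^2\le\sum_{\lambda\in\Lambda}\left|\int f(x)e^{2\pi i\langle\lambda,x\rangle}d\rho(x)\right|^2\le B\|f\|_{L^2(\rho)}^2$ for all $f\in L^2(\rho)$. Translational absolute continuity: for a finite Borel measure $\rho$, let $K_\rho$ be its closed support (the smallest closed set of full $\rho$-measure). A Borel set $X$ is a Borel support of $\rho$ if $X\subset K_\rho$ and $\rho(X)=\rho(K_\rho)$. For a Borel set $E\subset K_\rho$ with $\rho(E)>0$, $\rho$ is translationally absolutely continuous on $E$ if for every $t\in\mathbb{R}^d$ the measure $\omega_t(F):=\rho((F+t)\cap(E+t))$ is absolutely continuous with respect to $\rho$.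 The measure $\rho$ is translationally absolutely continuous if there is a Borel support $X$ of $\rho$ such that $\rho$ is translationally absolutely continuous on every Borel set $E\subset X$ with $\rho(E)>0$; otherwise $\rho$ is translationally singular. *)

(* Defs.v *)
From HB Require Import structures.
From mathcomp Require Import all_boot all_order all_algebra.
From mathcomp Require Import all_classical all_reals all_analysis.
From mathcomp Require Import measurable_realfun complex.

Set Implicit Arguments.
Unset Strict Implicit.
Unset Printing Implicit Defensive.

Import Order.TTheory GRing.Theory Num.Theory.
Import numFieldNormedType.Exports.
Import ComplexField.Normc.

Local Open Scope classical_set_scope.
Local Open Scope ring_scope.

(* Matrix types, in particular R^d = 'rV[R]_d, carry their Borel sigma-algebra. *)
HB.instance Definition _ (R : realType) (m n : nat) :=
  Measurable.copy 'M[R]_(m, n) (g_sigma_algebraType (@open 'M[R]_(m, n))).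

Section borel_rV.
Context {R : realType} {d : nat}.

Lemma open_measurable_rV (U : set 'rV[R]_d) : open U -> measurable U.
Proof. by move=> oU; apply: sub_sigma_algebra. Qed.

Lemma open_rV_bigcup (U : set 'rV[R]_d) : open U ->
  U = \bigcup_(p in [set p : 'rV[rat]_d * nat |
        (ball (\row_i (ratr (p.1 ord0 i) : R)) p.2.+1%:R^-1 : set 'rV[R]_d) `<=` U])
      ball (\row_i (ratr (p.1 ord0 i) : R)) p.2.+1%:R^-1.
Proof.
move=> oU; apply/seteqP; split => [x Ux|x [p /= pU]]; last exact: pU.
have /nbhs_ballP[e /= e0 eU] : nbhs x U by exact: open_nbhs_nbhs.
pose n := Num.truncn (2 / e).
have n0 : 0 < n.+1%:R^-1 :> R by rewrite invr_gt0 ltr0n.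
have en : n.+1%:R^-1 + n.+1%:R^-1 < e.
  rewrite -mulr2n -[ltLHS]mulr_natl ltr_pdivrMr ?ltr0n// mulrC -ltr_pdivrMr//.
  by have := truncnS_gt (2 / e).
have H (i : 'I_d) : exists q : rat, ball (x ord0 i) n.+1%:R^-1 (ratr q : R).
  have : x ord0 i < x ord0 i + n.+1%:R^-1 by rewrite ltrDl.
  move=> /rat_in_itvoo[q]; rewrite in_itv/= => /andP[q1 q2]; exists q.
  by rewrite /ball/= ltr_distlC q2 (lt_trans _ q1)// ltrBlDr ltrDl.
pose q : 'rV[rat]_d := \row_i projT1 (cid (H i)).
have xq : ball x n.+1%:R^-1 (\row_i (ratr (q ord0 i) : R)).
  by split=> // i j; rewrite (ord1 i) !mxE; exact: projT2 (cid (H j)).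
exists (q, n) => /=; last exact: ball_sym.
move=> y qy; apply: eU; apply: le_ball (ltW en) _ _; exact: ball_triangle xq qy.
Qed.

Lemma measurable_coord (i : 'I_d) :
  measurable_fun setT (fun x : 'rV[R]_d => x ord0 i).
Proof.
apply: (measurability (@RGenOpens.G R)).
  by rewrite [LHS]RGenOpens.measurableE.
move=> _ [_ [a [b ->]] <-]; rewrite setTI; apply: open_measurable_rV.
apply: open_comp; last exact: interval_open.
by move=> x _; exact: coord_continuous.
Qed.

Lemma measurable_rowP d' (T : measurableType d') (f : T -> 'rV[R]_d) :
  (forall i, measurable_fun setT (fun x => f x ord0 i)) -> measurable_fun setT f.
Proof.
move=> mf; apply: (@measurability _ _ _ _ _ _ (@open 'rV[R]_d)) => //.
move=> _ [U oU <-]; rewrite setTI (open_rV_bigcup oU) preimage_bigcup.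
rewrite bigcup_mkcond; apply: countable_bigcupT_measurable => [|[q n]].
  exact: countableP.
case: ifP => // _ /=.
rewrite [X in measurable X](_ : _ = \bigcap_(i : 'I_d)
   (fun x => f x ord0 i) @^-1` ball (ratr (q ord0 i) : R) n.+1%:R^-1).
  apply: fin_bigcap_measurable => // i _; rewrite -[X in measurable X]setTI.
  by apply: mf => //; exact: measurable_ball.
apply/seteqP; split => x /=.
  by move=> [_ h] i _; have := h ord0 i; rewrite mxE.
move=> h; split; rewrite ?invr_gt0 ?ltr0n// => j i.
by rewrite (ord1 j) mxE; exact: h.
Qed.

Lemma measurable_addrV :
  measurable_fun setT (fun z : 'rV[R]_d * 'rV[R]_d => z.1 + z.2).
Proof.
apply: measurable_rowP => i; under eq_fun do rewrite mxE.
apply: measurable_funD.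
  exact: (measurableT_comp (measurable_coord i) measurable_fst).
exact: (measurableT_comp (measurable_coord i) measurable_snd).
Qed.

End borel_rV.

Section convolution.
Local Open Scope ereal_scope.
Context {R : realType} {d : nat}.
Variables nu lambda : {finite_measure set 'rV[R]_d -> \bar R}.

Definition convolution (E : set 'rV[R]_d) : \bar R :=
  \int[lambda]_y \int[nu]_x (\1_E (x + y)%R)%:E.

Lemma convolutionE E : measurable E ->
  convolution E = (nu \x^ lambda) ((fun z => (z.1 + z.2)%R) @^-1` E).
Proof.
move=> mE; apply: eq_integral => y _ /=.
have mA : measurable ((fun z : 'rV[R]_d * 'rV[R]_d => (z.1 + z.2)%R) @^-1` E).
  by rewrite -[X in measurable X]setTI; exact: measurable_addrV.
rewrite -[X in nu X]setIT -integral_indic//; last exact: measurable_ysection.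
by apply: eq_integral => x _; rewrite !indicE mem_ysection.
Qed.

Let convolution0 : convolution set0 = 0.
Proof. by rewrite convolutionE// preimage_set0 measure0. Qed.

Let convolution_ge0 E : 0 <= convolution E.
Proof.
apply: integral_ge0 => y _; apply: integral_ge0 => x _.
by rewrite lee_fin indicE.
Qed.

Let convolution_sigma_additive : semi_sigma_additive convolution.
Proof.
move=> F mF tF mUF; rewrite convolutionE// preimage_bigcup.
rewrite [X in X @ _ --> _](_ : _ = fun n => \sum_(0 <= i < n)
    (nu \x^ lambda) ((fun z => (z.1 + z.2)%R) @^-1` F i)); last first.
  by apply/funext => n; apply: eq_bigr => i _; exact: convolutionE.
have mA n : measurable ((fun z : 'rV[R]_d * 'rV[R]_d => (z.1 + z.2)%R) @^-1` F n).
  by rewrite -[X in measurable X]setTI; exact: measurable_addrV.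
apply: measure_semi_sigma_additive => //; last exact: bigcupT_measurable.
apply/trivIsetP => /= i j _ _ ij; rewrite -preimage_setI.
by move/trivIsetP : tF => /(_ _ _ _ _ ij) ->//; rewrite preimage_set0.
Qed.

HB.instance Definition _ := isMeasure.Build _ _ _ convolution
  convolution0 convolution_ge0 convolution_sigma_additive.

Let convolution_fin : fin_num_fun convolution.
Proof.
apply: lty_fin_num_fun => /=; rewrite convolutionE// preimage_setT -setXTT.
rewrite product_measure2E//.
by rewrite lte_mul_pinfty ?ltey_eq ?fin_num_measure// fin_num_measure.
Qed.

HB.instance Definition _ :=
  Measure_isFinite.Build _ _ _ convolution convolution_fin.

End convolution.

Section finite_measure_add.
Local Open Scope ereal_scope.
Context d (T : measurableType d) (R : realType).
Variables m1 m2 : {finite_measure set T -> \bar R}.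

HB.instance Definition _ := Measure.on (measure_add m1 m2).

Let measure_add_fin : fin_num_fun (measure_add m1 m2).
Proof.
by move=> A mA; rewrite measure_addE fin_numD !fin_num_measure.
Qed.

HB.instance Definition _ :=
  Measure_isFinite.Build _ _ _ (measure_add m1 m2) measure_add_fin.

End finite_measure_add.

Definition difference_set (R : realType) (d : nat) (A : set 'rV[R]_d) :
  set 'rV[R]_d := [set a - a' | a in A & a' in A].

Definition packing_pair (R : realType) (d : nat) (K1 K2 : set 'rV[R]_d) : Prop :=
  difference_set K1 `&` difference_set K2 = [set 0].

Definition translate (R : realType) (d : nat) (t : 'rV[R]_d)
  (A : set 'rV[R]_d) : set 'rV[R]_d := [set x + t | x in A].

Section borel_measures.
Local Open Scope ereal_scope.
Context {R : realType} {d : nat}.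
Implicit Types rho : {finite_measure set 'rV[R]_d -> \bar R}.

Definition supported_on rho (K : set 'rV[R]_d) : Prop := rho (~` K) = 0.

Definition without_atoms rho : Prop := forall x, rho [set x] = 0.

Definition closed_support rho : set 'rV[R]_d :=
  \bigcap_(C in [set C | closed C /\ rho (~` C) = 0]) C.

Lemma closed_closed_support rho : closed (closed_support rho).
Proof. by apply: closed_bigI => C []. Qed.

(* The smallest closed set of full measure thus exists. *)
Lemma closed_support_full rho : rho (~` closed_support rho) = 0.
Proof.
pose V (p : 'rV[rat]_d * nat) : set 'rV[R]_d :=
  ball (\row_i (ratr (p.1 ord0 i) : R)) p.2.+1%:R^-1.
pose N k := if unpickle k is Some p then
              if rho (V p) == 0 then V p else set0 else set0.
have mV p : measurable (V p).
  by apply: open_measurable_rV; apply: ball_open; rewrite ?invr_gt0 ?ltr0n.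
have N0 k : rho.-negligible (N k).
  rewrite /N; case: unpickle => [p|]; last exact: negligible_set0.
  case: eqP => [p0|_]; last exact: negligible_set0.
  by exists (V p); split.
have mS : measurable (~` closed_support rho).
  by apply: open_measurable_rV; apply: closed_openC; exact: closed_closed_support.
apply: (measure0_null_setP rho mS).1; apply: negligible_null_set.
apply: negligibleS (negligible_bigcup N0) => x /= /existsNP[C] /not_implyP[[cC C0] Cx].
have oC : open (~` C) by exact: closed_openC.
have : (~` C) x by [].
rewrite (open_rV_bigcup oC) => -[p /= pC px].
exists (pickle p) => //; rewrite /N pickleK.
suff -> : rho (V p) == 0 by [].
rewrite -measure_le0 -C0 le_measure ?inE//.
exact: open_measurable_rV.
Qed.

Definition borel_support rho (X : set 'rV[R]_d) : Prop :=
  [/\ measurable X, X `<=` closed_support rho & rho X = rho (closed_support rho)].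

Definition translationally_ac_on rho (E : set 'rV[R]_d) : Prop :=
  forall t, (fun F => rho (translate t F `&` translate t E)) `<< rho.

Definition translationally_ac rho : Prop :=
  exists2 X, borel_support rho X &
    forall E, measurable E -> E `<=` X -> 0 < rho E -> translationally_ac_on rho E.

Definition translationally_singular rho : Prop := ~ translationally_ac rho.

End borel_measures.

Section fourier_frames.
Context {R : realType} {d : nat}.
Implicit Types (rho : {finite_measure set 'rV[R]_d -> \bar R})
  (f : 'rV[R]_d -> R[i]) (l x : 'rV[R]_d).

Definition cintegral rho f : R[i] :=
  Complex (\int[rho]_x complex.Re (f x)) (\int[rho]_x complex.Im (f x)).

Definition sqnormL2 rho f : \bar R := (\int[rho]_x (normc (f x) ^+ 2)%:E)%E.

Definition in_L2 rho f : Prop :=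
  [/\ measurable_fun setT (fun x => complex.Re (f x)),
      measurable_fun setT (fun x => complex.Im (f x)) & (sqnormL2 rho f < +oo)%E].

Definition dotmul l x : R := \sum_(i < d) l ord0 i * x ord0 i.

Definition expi (theta : R) : R[i] := Complex (cos theta) (sin theta).

Definition fourier_coef rho f l : R[i] :=
  cintegral rho (fun x => f x * expi (2 * pi * dotmul l x)).

Definition fourier_frame rho (L : set 'rV[R]_d) (A B : R) : Prop :=
  forall f, in_L2 rho f ->
    (A%:E * sqnormL2 rho f <= \esum_(l in L) (normc (fourier_coef rho f l) ^+ 2)%:E
      <= B%:E * sqnormL2 rho f)%E.

Definition admits_fourier_frame rho : Prop :=
  exists (L : set 'rV[R]_d) (A B : R),
    [/\ countable L, 0 < A, A <= B & fourier_frame rho L A B].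

End fourier_frames.

(* Main.v *)
Require Import Defs.
From mathcomp Require Import all_boot all_order all_algebra.
From mathcomp Require Import all_classical all_reals all_analysis.
From mathcomp Require Import measurable_realfun complex ring lra.

Import numFieldNormedType.Exports.
Local Open Scope classical_set_scope.
Local Open Scope ring_scope.

(* Since K1 + K2 is a bijective image of K1 x K2 and lambda has no atoms, mu does
   not charge any translate of K1, so mu and delta_t * nu are mutually singular.

   Translational singularity: given a Borel support X, the set E := X \ (K1 + t)
   carries all of mu, hence nu (E - y) > 0 for some y. The set F := E n (K1 + y)
   is then null for mu and for delta_t * nu, but its translate by t - y is a part
   of K1 + t of measure nu (E - y) > 0.

   No Fourier frame: for S in K2 let f be the indicator of (K1 + S) \ (K1 + t).
   Its Fourier coefficients are hat(nu) * hat(lambda|S), bounded in modulus by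
   2 lambda(S) |hat(nu)|, which are the moduli of the Fourier coefficients of
   g := 2 lambda(S) 1_(K1 + t). The frame inequalities for f and g thus give
   A nu(K1) lambda(S) <= 4 B lambda(S)^2 nu(K1), which is impossible for a set S
   of small positive measure; such sets exist because lambda has no atoms. *)

Set Implicit Arguments.
Unset Strict Implicit.
Unset Printing Implicit Defensive.

Import Order.TTheory GRing.Theory Num.Theory.
Import ComplexField.Normc.

(** * Integration against a convolution *)

Section integrals.
Local Open Scope ereal_scope.
Context {R : realType}.

Lemma integrable_bounded_measurable dd (T : measurableType dd)
    (m : {measure set T -> \bar R}) (D : set T) (g : T -> R) (M : R) :
  m setT < +oo -> measurable D -> measurable_fun setT g ->
  (forall x, (`|g x| <= M)%R) -> m.-integrable D (EFin \o g).
Proof.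
move=> mT mD mg gM; apply: measurable_bounded_integrable => //.
- by rewrite (le_lt_trans _ mT)// le_measure ?inE.
- exact: measurable_funTS.
- exists M; split; first by rewrite num_real.
  by move=> N MN x _; exact: le_trans (gM x) (ltW MN).
Qed.

Context {d : nat}.
Implicit Types n m : {finite_measure set 'rV[R]_d -> \bar R}.

Lemma finite_measureT_lty n : n setT < +oo.
Proof. by rewrite ltey_eq fin_num_measure. Qed.

(* The hypothesis on A and S says that addition pulls A back to setT `*` S, up to
   null sets. *)
Lemma Rintegral_convolution n m (P Q A S : set 'rV[R]_d) (g : 'rV[R]_d -> R)
    (M : R) :
  measurable P -> n (~` P) = 0 -> measurable Q -> m (~` Q) = 0 ->
  measurable A -> measurable S ->
  (forall x y, P x -> Q y -> A (x + y)%R <-> S y) ->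
  measurable_fun setT g -> (forall x, (`|g x| <= M)%R) ->
  (\int[convolution n m]_(z in A) g z =
   \int[m]_(y in S) (\int[n]_x g (x + y)))%R.
Proof.
move=> mP nP mQ mQ0 mA mS PQAS mg gM.
pose add (z : 'rV[R]_d * 'rV[R]_d) := (z.1 + z.2)%R.
have madd : measurable_fun setT add by exact: measurable_addrV.
have mga : measurable_fun setT (g \o add) by exact: measurableT_comp.
have mAadd : measurable (add @^-1` A).
  by rewrite -[X in measurable X]setTI; exact: madd.
have nmT1 : (n \x m) setT < +oo.
  rewrite -setXTT product_measure1E// lte_mul_pinfty ?fin_num_measure//.
  exact: finite_measureT_lty.
have nmT2 : (n \x^ m) setT < +oo.
  rewrite -setXTT product_measure2E// lte_mul_pinfty ?fin_num_measure//.
  exact: finite_measureT_lty.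
have ig D : measurable D -> (n \x^ m).-integrable D (EFin \o (g \o add)).
  move=> mD.
  by apply: (integrable_bounded_measurable (M := M)) => // x; exact: gM.
have mXS : measurable (setT `*` S : set ('rV[R]_d * 'rV[R]_d)).
  exact: measurableX.
have -> : (\int[convolution n m]_(z in A) g z)%R =
    fine (\int[n \x^ m]_(z in add @^-1` A) (g (add z))%:E).
  rewrite /Rintegral; congr fine.
  transitivity (\int[pushforward (n \x^ m) add]_(z in A) (g z)%:E).
    by apply: eq_measure_integral => E mE _; rewrite /= convolutionE.
  rewrite integral_pushforward//; first exact/measurable_EFinP.
  exact: ig.
(* [N] is the complement of [P] x [Q], a null set; off [N] the hypothesis on [A] and [S] identifies
   the two domains of integration. *)
pose N : set ('rV[R]_d * 'rV[R]_d) := ((~` P) `*` setT) `|` (setT `*` (~` Q)).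
have mN : measurable N.
  by apply: measurableU; apply: measurableX => //; exact: measurableC.
have N0 : (n \x^ m) N = 0.
  have mPc := measurableC mP; have mQc := measurableC mQ.
  have N1 : (n \x^ m) ((~` P) `*` setT) = 0.
    by rewrite product_measure2E// [X in X * _]nP mul0e.
  have N2 : (n \x^ m) (setT `*` (~` Q)) = 0.
    by rewrite product_measure2E// [X in _ * X]mQ0 mule0.
  by rewrite measureU0 ?N1//; exact: measurableX.
have -> : \int[n \x^ m]_(z in add @^-1` A) (g (add z))%:E =
    \int[n \x^ m]_(z in setT `*` S) (g (add z))%:E.
  rewrite (negligible_integral mN mAadd (ig _ mAadd) N0).
  rewrite (negligible_integral mN mXS (ig _ mXS) N0).
  congr (integral _ _ _); apply/seteqP; split => -[x y]/= [] + Nxy.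
    move=> Axy; split=> //; split=> //.
    by apply/(PQAS x y) => //; apply: contrapT => ?; apply: Nxy; [left|right].
  move=> [_ Sy]; split=> //.
  by apply/(PQAS x y) => //; apply: contrapT => ?; apply: Nxy; [left|right].
rewrite integral_mkcond.
(* The restriction to [S] becomes a factor of the integrand, so that Fubini applies on the whole
   product space. *)
pose h (z : 'rV[R]_d * 'rV[R]_d) := (g (add z) * \1_S z.2)%R.
have mh : measurable_fun setT h.
  apply: measurable_funM => //.
  have mI : measurable_fun setT (\1_S : 'rV[R]_d -> R) by exact: measurable_indic.
  exact: (measurableT_comp mI measurable_snd).
have ih : (n \x m).-integrable setT (EFin \o h).
  apply: (integrable_bounded_measurable (M := M)) => // x.
  rewrite /h normrM (le_trans _ (gM (add x)))// ler_piMr//.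
  by rewrite indicE; case: (_ \in _); rewrite ?normr1 ?normr0.
rewrite (_ : patch _ _ _ = EFin \o h); last first.
  apply/funext => -[x y]; rewrite /patch/h/= indicE.
  have [yS|yS] := boolP (y \in S).
    by rewrite ifT ?mulr1// in_setX/= in_setT.
  by rewrite ifF ?mulr0// in_setX (negbTE yS) andbF.
rewrite -(integral21_prod_meas2 ih) /Rintegral; congr fine.
rewrite [RHS]integral_mkcond; apply: eq_integral => y _.
rewrite /fubini_G /patch/= /h/=; case: ifPn => [yS|/negbTE yS].
  rewrite fineK; last first.
    apply: integrable_fin_num => //.
    apply: (integrable_bounded_measurable (M := M)) => //.
      exact: finite_measureT_lty.
    have mpair : measurable_fun setT (fun x : 'rV[R]_d => (x, y)).
      exact: pair2_measurable.
    exact: (measurableT_comp mga mpair).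
  by apply: eq_integral => x _; rewrite indicE yS mulr1.
by apply: integral0_eq => x _; rewrite indicE yS mulr0.
Qed.

End integrals.

(** * Borel sets, sumsets and translates *)

Section topology.
Context {R : realType} {d : nat}.
Implicit Types (A B : set 'rV[R]_d) (x y t : 'rV[R]_d).

Lemma closed_measurable_rV A : closed A -> measurable A.
Proof.
move=> cA; rewrite -[A]setCK; apply: measurableC.
by apply: open_measurable_rV; exact: closed_openC.
Qed.

Lemma compact_measurable_rV A : compact A -> measurable A.
Proof.
by move=> cA; apply: closed_measurable_rV; exact: compact_closed cA.
Qed.

(** Sumsets of Borel sets need not be Borel; compactness of both summands is what will make [K1] +
    [S] measurable. *)
Lemma compact_sumset A B : compact A -> compact B ->
  compact [set z.1 + z.2 | z in A `*` B].
Proof.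
move=> cA cB; apply: continuous_compact; last exact: compact_setX.
by apply: continuous_subspaceT; exact: add_continuous.
Qed.

Lemma measurable_addr t : measurable_fun setT (fun x => x + t).
Proof.
exact: (measurableT_comp measurable_addrV (pair2_measurable _)).
Qed.

Lemma translateE t A : translate t A = (fun x => x - t) @^-1` A.
Proof.
apply/seteqP; split=> [_ [x Ax <-]|x /= Ax]; first by rewrite /= addrK.
by exists (x - t) => //; rewrite subrK.
Qed.

Lemma measurable_translate t A : measurable A -> measurable (translate t A).
Proof.
move=> mA; rewrite translateE -[X in measurable X]setTI.
exact: measurable_addr.
Qed.

End topology.

(** * Closed supports and small sets of positive measure *)

Section support.
Context {R : realType} {d : nat}.
Implicit Types (m : {finite_measure set 'rV[R]_d -> \bar R}) (K : set 'rV[R]_d).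
Local Open Scope ereal_scope.

Lemma measure_setI_full m K A : measurable K -> m (~` K) = 0 -> measurable A ->
  m (A `&` K) = m A.
Proof.
move=> mK K0 mA; rewrite [RHS](measureDI m mA mK).
rewrite (@subset_measure0 _ _ _ _ (A `\` K) (~` K)) ?add0e//.
- exact: measurableD.
- exact: measurableC.
Qed.

(** If the ball were null, its complement would be a closed set of full measure missing [x], while
    the closed support lies in every such set. *)
Lemma ball_closed_support_gt0 m x (r : R) :
  closed_support m x -> (0 < r)%R -> 0 < m (ball x r).
Proof.
move=> mx r0; rewrite lt0e measure_ge0 andbT; apply/eqP => b0.
have /mx : [set C | closed C /\ m (~` C) = 0] (~` ball x r).
  by split; [by apply: open_closedC; exact: ball_open | rewrite setCK].
by apply; exact: ballxx.
Qed.

(* Balls around a point x of the closed support have positive measure, decreasing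
   to m [set x] = 0. *)
Lemma exists_small_compact m K (e : R) :
  without_atoms m -> compact K -> m (~` K) = 0 -> m setT <> 0 -> (0 < e)%R ->
  exists S, [/\ compact S, S `<=` K & 0 < m S < e%:E].
Proof.
move=> am cK mK m0 e0; have mmK := compact_measurable_rV cK.
have [x mx] : closed_support m !=set0.
  apply/set0P/negP => /eqP m00; apply: m0.
  by have := closed_support_full m; rewrite m00 setC0.
pose F k := closed_ball x k.+1%:R^-1.
have k0 k : (0 < k.+1%:R^-1 :> R)%R by rewrite invr_gt0 ltr0n.
have mF k : measurable (F k).
  by apply: closed_measurable_rV; exact: closed_ball_closed.
have FE : \bigcap_k F k = [set x].
  apply/seteqP; split => [y Fy|_ -> k _]; last exact: closed_ballxx.
  apply: contrapT => /eqP yx.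
  have yx0 : (0 < `|x - y|)%R by rewrite normr_gt0 subr_eq0 eq_sym.
  (* With this [k] the radius 1/(k+1) is smaller than the distance from [x] to [y], so [y] is not in
     [F k]. *)
  pose k := Num.truncn (`|x - y|^-1)%R.
  have := Fy k I; rewrite /F closed_ballE//= /closed_ball_/= => xyk.
  have := truncnS_gt (`|x - y|^-1)%R; rewrite -/k.
  rewrite -[ltRHS]invrK ltf_pV2 ?posrE// => /(le_lt_trans xyk).
  by rewrite ltxx.
have cF : m \o F @ \oo --> m [set x].
  rewrite -FE; apply: nonincreasing_cvg_mu => //.
  - by rewrite (le_lt_trans _ (finite_measureT_lty m))// le_measure ?inE.
  - by rewrite FE -FE; exact: bigcapT_measurable.
  - move=> i j ij; rewrite subsetEset /F => y.
    rewrite !closed_ballE//= => /le_trans; apply.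
    by rewrite lef_pV2 ?posrE ?ltr0n// ler_nat.
have [k mFk] : exists k, m (F k) < e%:E.
  move: cF; rewrite am => /fine_cvgP[].
  move=> [N _ NF] /cvgrPdist_lt/(_ _ e0)[N' _ N'F].
  (* Beyond [N] the measures are finite, and beyond [N'] their real values are below [e]. *)
  exists (maxn N N'); have := N'F (maxn N N') (leq_maxr _ _).
  rewrite /= sub0r normrN ger0_norm ?fine_ge0// -lte_fin fineK//.
  exact: NF (leq_maxl _ _).
exists (K `&` F k); split.
- apply: (subclosed_compact _ cK) => //.
  by apply: closedI; [exact: compact_closed cK | exact: closed_ball_closed].
- exact: subIsetl.
- rewrite setIC measure_setI_full//.
  rewrite mFk andbT (lt_le_trans (ball_closed_support_gt0 mx (k0 k)))//
    le_measure ?inE//; last exact: subset_closed_ball.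
  by apply: open_measurable_rV; exact: ball_open.
Qed.

End support.

(** * Values of a convolution on special sets *)

Section convolution_facts.
Context {R : realType} {d : nat}.
Implicit Types n m : {finite_measure set 'rV[R]_d -> \bar R}.
Implicit Types P Q A S E : set 'rV[R]_d.
Local Open Scope ereal_scope.

(** This is [Rintegral_convolution] for the constant function 1, read back in the extended reals. *)
Lemma convolution_rectangle n m P Q A S :
  measurable P -> n (~` P) = 0 -> measurable Q -> m (~` Q) = 0 ->
  measurable A -> measurable S ->
  (forall x y, P x -> Q y -> A (x + y)%R <-> S y) ->
  convolution n m A = n setT * m S.
Proof.
move=> mP nP mQ mQ0 mA mS PQAS.
have fc : convolution n m A \is a fin_num by exact: fin_num_measure.
rewrite -(fineK fc).
have m1 : measurable_fun setT (cst 1%R : 'rV[R]_d -> R) by exact: measurable_cst.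
have b1 (x : 'rV[R]_d) : (`|cst 1 x| <= 1 :> R)%R by rewrite normr1.
have := Rintegral_convolution mP nP mQ mQ0 mA mS PQAS m1 b1.
under [in RHS]eq_Rintegral => y _ do rewrite Rintegral_cst// mul1r.
rewrite !Rintegral_cst// mul1r => ->.
by rewrite EFinM !fineK ?fin_num_measure.
Qed.

Lemma convolution_eq0 n m P E :
  measurable P -> n (~` P) = 0 -> measurable E ->
  (forall x, P x -> m [set y | E (x + y)%R] = 0) ->
  convolution n m E = 0.
Proof.
move=> mP nP mE PE; rewrite convolutionE//.
set X := _ @^-1` E.
have mX : measurable X.
  by rewrite -[X in measurable X]setTI; exact: measurable_addrV.
(* The convolution integrates over [n] first, whereas the hypothesis bounds the slices measured by
   [m]; uniqueness of the product measure permits exchanging the order. *)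
have <- : (n \x m) X = (n \x^ m) X.
  by apply: product_measure_unique => // A B mA mB /=; rewrite product_measure2E.
rewrite /product_measure1 (@ge0_negligible_integral _ _ _ _ _ (~` P))//.
- rewrite setDE setCK; apply: integral0_eq => x [_ Px] /=.
  rewrite -[RHS](PE x Px); congr (m _); apply/seteqP; split=> y /=.
    by rewrite /xsection/= inE.
  by rewrite /xsection/= inE.
- exact: measurableC.
- exact: measurable_fun_xsection.
Qed.

Lemma convolution_dirac (t : 'rV[R]_d) m E : measurable E ->
  convolution (dirac t) m E = m [set y | E (t + y)%R].
Proof.
move=> mE; rewrite /convolution.
have mtE : measurable [set y | E (t + y)%R].
  rewrite (_ : [set _ | _] = (fun y => (y + t)%R) @^-1` E).
    rewrite -[X in measurable X]setTI; exact: measurable_addr.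
  by apply/seteqP; split => y /=; rewrite addrC.
rewrite -[in RHS](setIT [set y | _]) -integral_indic//; apply: eq_integral => y _.
rewrite integral_dirac//.
  by rewrite diracT mul1e !indicE; congr (_%:E); congr (_%:R).
apply/measurable_EFinP.
have mI : measurable_fun setT (\1_E : 'rV[R]_d -> R) by exact: measurable_indic.
exact: (measurableT_comp mI (measurable_addr _)).
Qed.

End convolution_facts.

(** * Fourier integrals over Borel sets *)

Section fourier.
Context {R : realType} {d : nat}.
Implicit Types (n m : {finite_measure set 'rV[R]_d -> \bar R}) (k : R).
Implicit Types (A B S : set 'rV[R]_d) (l x t : 'rV[R]_d).

Definition phase l x : R := 2 * pi * dotmul l x.

Lemma phaseD l x y : phase l (x + y) = phase l x + phase l y.
Proof.
rewrite /phase -mulrDr; congr (_ * _); rewrite /dotmul -big_split/=.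
by apply: eq_bigr => i _; rewrite mxE mulrDr.
Qed.

Lemma measurable_phase l : measurable_fun setT (phase l).
Proof.
apply: measurable_funM => //; rewrite /dotmul.
apply: measurable_sum => i; apply: measurable_funM => //.
exact: measurable_coord.
Qed.

Lemma measurable_cos_phase l : measurable_fun setT (fun x => cos (phase l x)).
Proof.
apply: (measurableT_comp (f := cos)); last exact: measurable_phase.
by apply: continuous_measurable_fun; exact: continuous_cos.
Qed.

Lemma measurable_sin_phase l : measurable_fun setT (fun x => sin (phase l x)).
Proof.
apply: (measurableT_comp (f := sin)); last exact: measurable_phase.
by apply: continuous_measurable_fun; exact: continuous_sin.
Qed.

(** The Fourier transform at [l] of [m] restricted to [S], kept as two real integrals so that real
    integration lemmas apply to each part. *)
Definition fourier_on m (S : set 'rV[R]_d) l : R[i] :=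
  Complex (\int[m]_(x in S) cos (phase l x)) (\int[m]_(x in S) sin (phase l x)).

Lemma integrable_cos_phase m (D : set 'rV[R]_d) l : measurable D ->
  m.-integrable D (EFin \o (fun x => cos (phase l x))).
Proof.
move=> mD; apply: (integrable_bounded_measurable (M := 1)) => //.
- exact: finite_measureT_lty.
- exact: measurable_cos_phase.
- by move=> x; exact: cos_max.
Qed.

Lemma integrable_sin_phase m (D : set 'rV[R]_d) l : measurable D ->
  m.-integrable D (EFin \o (fun x => sin (phase l x))).
Proof.
move=> mD; apply: (integrable_bounded_measurable (M := 1)) => //.
- exact: finite_measureT_lty.
- exact: measurable_sin_phase.
- by move=> x; exact: sin_max.
Qed.

Lemma integrableZrR m (D : set 'rV[R]_d) (f : 'rV[R]_d -> R) (k : R) :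
  measurable D -> m.-integrable D (EFin \o f) ->
  m.-integrable D (EFin \o (fun x => f x * k)).
Proof.
move=> mD /(integrableZr mD k); exact: eq_integrable.
Qed.

(** The character at [x + y] is the product of the characters at [x] and [y], and the domain only
    constrains [y], so the double integral factors. *)
Lemma fourier_on_convolution n m (P Q A S : set 'rV[R]_d) l :
  measurable P -> n (~` P) = 0%E -> measurable Q -> m (~` Q) = 0%E ->
  measurable A -> measurable S ->
  (forall x y, P x -> Q y -> A (x + y) <-> S y) ->
  fourier_on (convolution n m) A l = fourier_on n setT l * fourier_on m S l.
Proof.
move=> mP nP mQ mQ0 mA mS PQAS; rewrite /fourier_on.
have iC D := @integrable_cos_phase n D l.
have iS D := @integrable_sin_phase n D l.
have jC D := @integrable_cos_phase m D l.
have jS D := @integrable_sin_phase m D l.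
rewrite (Rintegral_convolution mP nP mQ mQ0 mA mS PQAS
  (measurable_cos_phase l) (fun x => cos_max _)).
rewrite (Rintegral_convolution mP nP mQ mQ0 mA mS PQAS
  (measurable_sin_phase l) (fun x => sin_max _)).
rewrite /GRing.mul/=; congr Complex.
(* The addition formula for cosine splits the inner integral; factors in [y] alone come out, and the
   outer integral is then treated alike. The sine part is analogous. *)
- under eq_Rintegral => y _.
    under eq_Rintegral => x _ do rewrite phaseD cosD.
    rewrite RintegralB//;
      [|exact: integrableZrR (iC _ _)|exact: integrableZrR (iS _ _)].
    rewrite RintegralZr//; last exact: iC.
    rewrite RintegralZr//; last exact: iS.
    rewrite ![_ * cos _]mulrC ![_ * sin _]mulrC.
    over.
  rewrite RintegralB//;
    [|exact: integrableZrR (jC _ _)|exact: integrableZrR (jS _ _)].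
  rewrite RintegralZr//; last exact: jC.
  rewrite RintegralZr//; last exact: jS.
  by rewrite mulrC [X in _ - X]mulrC.
- under eq_Rintegral => y _.
    under eq_Rintegral => x _ do rewrite phaseD sinD.
    rewrite RintegralD//;
      [|exact: integrableZrR (iS _ _)|exact: integrableZrR (iC _ _)].
    rewrite RintegralZr//; last exact: iS.
    rewrite RintegralZr//; last exact: iC.
    rewrite ![_ * cos _]mulrC ![_ * sin _]mulrC.
    over.
  rewrite RintegralD//;
    [|exact: integrableZrR (jC _ _)|exact: integrableZrR (jS _ _)].
  rewrite RintegralZr//; last exact: jC.
  rewrite RintegralZr//; last exact: jS.
  by rewrite mulrC addrC; congr (_ + _); rewrite mulrC.
Qed.

(** The scalar [k] lets the same form serve both test functions [f] and [g] of the frame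
    argument. *)
Definition indic_fun k A : 'rV[R]_d -> R[i] :=
  fun x => Complex (k * \1_A x) 0.

Lemma real_mul_complex k (a b : R) :
  Complex k 0 * Complex a b = Complex (k * a) (k * b).
Proof. by apply/eqP; rewrite eq_complex/= !mul0r subr0 addr0 !eqxx. Qed.

Lemma fourier_coef_indic m k A l : measurable A ->
  fourier_coef m (indic_fun k A) l = Complex k 0 * fourier_on m A l.
Proof.
move=> mA; rewrite /fourier_coef /cintegral /fourier_on.
rewrite real_mul_complex; congr Complex.
- rewrite -RintegralZl//; last exact: integrable_cos_phase.
  rewrite [RHS]Rintegral_mkcond; apply: eq_Rintegral => x _.
  rewrite /= mul0r subr0 patchE indicE; case: ifP => _.
    by rewrite mulr1.
  by rewrite mulr0 mul0r.
- rewrite -RintegralZl//; last exact: integrable_sin_phase.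
  rewrite [RHS]Rintegral_mkcond; apply: eq_Rintegral => x _.
  rewrite /= mul0r addr0 patchE indicE; case: ifP => _.
    by rewrite mulr1.
  by rewrite mulr0 mul0r.
Qed.

Lemma sqnormL2_indic m k A : measurable A ->
  sqnormL2 m (indic_fun k A) = ((k ^+ 2)%:E * m A)%E.
Proof.
move=> mA; rewrite /sqnormL2.
rewrite -[in RHS](setIT A) -integral_indic//.
rewrite -ge0_integralZl//=; first last.
- by rewrite lee_fin sqr_ge0.
- exact/measurable_EFinP/measurable_indic.
apply: eq_integral => x _.
rewrite /indic_fun /normc/= expr0n addr0 sqrtr_sqr real_normK ?num_real//.
rewrite -EFinM exprMn indicE; case: (_ \in _); rewrite ?expr1n ?expr0n//.
Qed.

Lemma in_L2_indic m k A : measurable A -> in_L2 m (indic_fun k A).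
Proof.
move=> mA; split.
- exact: measurable_funM.
- exact: measurable_cst.
- by rewrite sqnormL2_indic// ltey_eq fin_numM// fin_num_measure.
Qed.

Lemma fourier_on_null m A l : measurable A -> m A = 0%E -> fourier_on m A l = 0.
Proof.
move=> mA A0; rewrite /fourier_on /Rintegral.
rewrite (negligible_integral mA mA (integrable_cos_phase _ _ mA) A0).
rewrite (negligible_integral mA mA (integrable_sin_phase _ _ mA) A0).
by rewrite setDv !integral_set0.
Qed.

Lemma fourier_on_add m1 m2 A l : measurable A ->
  fourier_on (measure_add m1 m2) A l = fourier_on m1 A l + fourier_on m2 A l.
Proof.
move=> mA; rewrite /fourier_on /Rintegral !integral_measure_add//;
  try (exact: integrable_cos_phase || exact: integrable_sin_phase).
have fC (m : {finite_measure set 'rV[R]_d -> \bar R}) :=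
  integrable_fin_num mA (integrable_cos_phase m l mA).
have fS (m : {finite_measure set 'rV[R]_d -> \bar R}) :=
  integrable_fin_num mA (integrable_sin_phase m l mA).
rewrite (fineD (fC m1) (fC m2)) (fineD (fS m1) (fS m2)).
by apply/eqP; rewrite eq_complex/= !eqxx.
Qed.

Lemma fourier_on_setD m A B l : measurable A -> measurable B -> m B = 0%E ->
  fourier_on m (A `\` B) l = fourier_on m A l.
Proof.
move=> mA mB B0; rewrite /fourier_on /Rintegral.
rewrite -(negligible_integral mB mA (integrable_cos_phase _ _ mA) B0).
by rewrite -(negligible_integral mB mA (integrable_sin_phase _ _ mA) B0).
Qed.

(** Translation by [t] thus changes Fourier coefficients by a phase only, not in modulus. *)
Lemma normc_fourier_on_dirac t l : normc (fourier_on (dirac t) setT l) = 1.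
Proof.
rewrite /fourier_on /Rintegral.
have mC : measurable_fun setT (fun x => (cos (phase l x))%:E).
  by apply/measurable_EFinP; exact: measurable_cos_phase.
have mS : measurable_fun setT (fun x => (sin (phase l x))%:E).
  by apply/measurable_EFinP; exact: measurable_sin_phase.
rewrite (integral_dirac _ _ mC)// (integral_dirac _ _ mS)//.
by rewrite diracT !mul1e /normc/= cos2Dsin2 sqrtr1.
Qed.

(** The cosine and sine integrals are each at most [m S] in absolute value; the factor 2 is a crude
    bound for their Euclidean combination. *)
Lemma normc_fourier_on_le m S l : measurable S ->
  normc (fourier_on m S l) <= 2 * fine (m S).
Proof.
move=> mS; rewrite /normc/=.
have H (g : 'rV[R]_d -> R) : measurable_fun setT g -> (forall x, `|g x| <= 1) ->
    `|\int[m]_(x in S) g x| <= fine (m S).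
  move=> mg g1.
  have ig : m.-integrable S (EFin \o g).
    exact: integrable_bounded_measurable (finite_measureT_lty m) mS mg g1.
  apply: (le_trans (le_normr_Rintegral mS ig)).
  rewrite -[leRHS]mul1r -Rintegral_cst//; apply: le_Rintegral => //.
    exact: (integrable_norm ig).
  exact: finite_measure_integrable_cst.
have := H _ (measurable_cos_phase l) (fun x => cos_max _).
have := H _ (measurable_sin_phase l) (fun x => sin_max _).
set a := Rintegral _ _ _; set b := Rintegral _ _ _; set s := fine _ => ha hb.
have s0 : 0 <= s by rewrite fine_ge0.
rewrite -(@ler_pXn2r _ 2)// ?nnegrE ?sqrtr_ge0 ?mulr_ge0//.
rewrite sqr_sqrtr ?addr_ge0 ?sqr_ge0//.
rewrite -(real_normK (num_real a)) -(real_normK (num_real b)).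
have := normr_ge0 a; have := normr_ge0 b.
nra.
Qed.

End fourier.

(** The closed support has full measure and [X] has the same measure; finiteness allows the
    subtraction. *)
Lemma borel_support_setC {R : realType} {d : nat}
    (rho : {finite_measure set 'rV[R]_d -> \bar R}) (X : set 'rV[R]_d) :
  borel_support rho X -> rho (~` X) = 0%E.
Proof.
move=> [mX _ rhoX].
have mC : measurable (closed_support rho).
  by apply: closed_measurable_rV; exact: closed_closed_support.
have rhoT : rho setT = rho X.
  by rewrite rhoX -(measure_setI_full mC (closed_support_full rho) measurableT) setTI.
have := measureDI rho measurableT mX; rewrite setTD setTI [X in X = _]rhoT.
move=> /(congr1 (fun z => z - rho X)%E).
by rewrite addeK ?subee ?fin_num_measure// => <-.
Qed.

(** * Packing pairs: singularity and absence of frames *)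

Section packing.
Context {R : realType} {d : nat}.
Variables (K1 K2 : set 'rV[R]_d) (nu lambda : {finite_measure set 'rV[R]_d -> \bar R}).
Hypotheses (cK1 : compact K1) (cK2 : compact K2) (K12 : packing_pair K1 K2).
Hypotheses (nuK1 : supported_on nu K1) (lambdaK2 : supported_on lambda K2).
Hypothesis lambda_diffuse : without_atoms lambda.

Let mK1 : measurable K1 := compact_measurable_rV cK1.
Let mK2 : measurable K2 := compact_measurable_rV cK2.

(** The common difference lies in both difference sets, hence is 0. This is injectivity of addition
    on [K1] x [K2]. *)
Lemma packing_pair_inj x x' y y' : K1 x -> K1 x' -> K2 y -> K2 y' ->
  x - x' = y' - y -> y = y'.
Proof.
move=> Kx Kx' Ky Ky' e.
have : (difference_set K1 `&` difference_set K2) (x - x').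
  split; first by exists x => //; exists x'.
  by rewrite e; exists y' => //; exists y.
by rewrite K12 /= e => /eqP; rewrite subr_eq0 => /eqP.
Qed.

Lemma convolution_translate_eq0 t : convolution nu lambda (translate t K1) = 0%E.
Proof.
have mT := measurable_translate t mK1.
apply: (convolution_eq0 mK1 nuK1 mT) => x Kx.
have mB : measurable [set y | translate t K1 (x + y)].
  rewrite (_ : [set _ | _] = (fun y => y + x) @^-1` translate t K1).
    by rewrite -[X in measurable X]setTI; exact: measurable_addr.
  by apply/seteqP; split => y /=; rewrite addrC.
rewrite -(measure_setI_full mK2 lambdaK2 mB).
(* For fixed [x], the part of the slice in [K2] is empty or a single point [y], which [lambda] does
   not charge. *)
have [->|/set0P[y [[x' Kx' xy] Ky]]] :=
  eqVneq ([set y | translate t K1 (x + y)] `&` K2) set0; first exact: measure0.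
apply: (subset_measure0 _ _ _ (lambda_diffuse y)).
- exact: measurableI.
- by apply: compact_measurable_rV; exact: compact_set1.
- move=> y' [[x'' Kx'' xy'] Ky'] /=.
  apply/esym/(packing_pair_inj Kx'' Kx' Ky Ky').
  have {xy'} -> : x'' = x + y' - t by rewrite -xy' addrK.
  have {xy} -> : x' = x + y - t by rewrite -xy addrK.
  by rewrite opprB addrA subrK opprD addrACA subrr add0r.
Qed.

Let mu := convolution nu lambda.
Let mK1t t := measurable_translate t mK1.

Lemma convolution_dirac_setC_translate t :
  convolution (dirac t) nu (~` translate t K1) = 0%E.
Proof.
rewrite convolution_dirac; last exact: measurableC.
rewrite -[RHS]nuK1; congr (nu _); rewrite translateE; apply/seteqP.
by split => y /=; rewrite addrC addKr.
Qed.

Hypotheses (nu_neq0 : nu setT <> 0%E) (lambda_neq0 : lambda setT <> 0%E).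

Lemma translationally_singular_packing t :
  translationally_singular (measure_add mu (convolution (dirac t) nu)).
Proof.
set dnu := convolution (dirac t) nu; set rho := measure_add mu dnu.
case=> X suppX Xac; have [mX _ _] := suppX.
have rhoXC : rho (~` X) = 0%E := borel_support_setC suppX.
have [muXC dnuXC] : mu (~` X) = 0%E /\ dnu (~` X) = 0%E.
  move: rhoXC => /eqP; rewrite [X in X == _ -> _]measure_addE.
  by rewrite padde_eq0// => /andP[/eqP muX /eqP dnuX]; split.
pose E := X `\` translate t K1.
have mE : measurable E by apply: measurableD.
(* Passing to [E] removes two [mu]-null sets: the complement of [X] and the translate of [K1]. *)
have muE : mu E = mu setT.
  have mT := mK1t t.
  transitivity (mu (setT `&` X)); last exact: measure_setI_full.
  rewrite setTI /E setDE.
  apply: measure_setI_full => //; first exact: measurableC.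
  by rewrite setCK; exact: convolution_translate_eq0.
have muE0 : mu E != 0%E.
  rewrite muE [X in X != _](@convolution_rectangle _ _ _ _ setT setT setT setT)//.
  - by rewrite mule_eq0; apply/norP; split; apply/eqP.
  - by rewrite setCT measure0.
  - by rewrite setCT measure0.
have mEy y : measurable [set x | E (x + y)].
  rewrite -[X in measurable X]setTI.
  exact: (measurable_addr y _ mE).
(* Otherwise every inner integral defining [mu E] would vanish. *)
have [y nuEy] : exists y, nu [set x | E (x + y)] != 0%E.
  apply: contrapT => /forallNP nuE; move/eqP: muE0; apply.
  rewrite /mu /convolution; apply: integral0_eq => y _.
  have := nuE y; move/negP; rewrite negbK => /eqP nuEy.
  rewrite -[RHS]nuEy -[in RHS](setIT [set x | _]) -integral_indic//.
have mF : measurable (E `&` translate y K1) by exact: measurableI.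
have rhoF : rho (E `&` translate y K1) = 0%E.
  rewrite [LHS]measure_addE.
  rewrite [X in (X + _)%E](subset_measure0 _ (mK1t y) (@subIsetr _ _ _))//; last first.
    exact: convolution_translate_eq0.
  rewrite [X in (_ + X)%E](subset_measure0 _ (measurableC (mK1t t)) _
    (convolution_dirac_setC_translate t))//; first by rewrite adde0.
  by move=> x [[_ +] _].
have rhoE : (0 < rho E)%E.
  rewrite [ltRHS]measure_addE (@lt_le_trans _ _ (mu E))//.
    by rewrite lt0e muE0 measure_ge0.
  by rewrite leeDl.
(* The shift [t - y] carries [K1] + [y] onto [K1] + [t], where [dnu] lives. *)
have /null_content_dominatesP/(_ _ mF rhoF) :=
  Xac E mE (@subDsetl _ _ _) rhoE (t - y).
move=> /eqP; rewrite [X in X == _ -> _]measure_addE.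
rewrite padde_eq0// => /andP[_ /eqP].
have mFE : measurable (translate (t - y) (E `&` translate y K1) `&`
    translate (t - y) E).
  by apply: measurableI; exact: measurable_translate.
move=> /(etrans (esym (convolution_dirac t nu mFE))) nu0; move/eqP: nuEy; apply.
rewrite -(measure_setI_full mK1 nuK1 (mEy y)) -[RHS]nu0; congr (nu _).
apply/seteqP; rewrite !translateE; split => x /=.
  have -> : t + x - (t - y) = x + y by rewrite opprB addrC addrA subrK addrC.
  by rewrite addrK => -[Exy Kx].
have -> : t + x - (t - y) = x + y by rewrite opprB addrC addrA subrK addrC.
by rewrite addrK => -[[Exy Kx] _].
Qed.

Lemma no_fourier_frame_packing t :
  ~ admits_fourier_frame (measure_add mu (convolution (dirac t) nu)).
Proof.
set dnu := convolution (dirac t) nu.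
case=> L [A [B [_ A0 AB frame]]].
have B0 : 0 < B := lt_le_trans A0 AB.
(* The threshold is chosen so that 4 B [lambda S] < A, contradicting the final frame inequality. *)
have [S [cS SK2 /andP[lS0 lSe]]] := @exists_small_compact _ _ lambda K2 (A / (4 * B))
  lambda_diffuse cK2 lambdaK2 lambda_neq0 (divr_gt0 A0 (mulr_gt0 (ltr0n _ 4) B0)).
have mS := compact_measurable_rV cS.
pose s := fine (lambda S).
have sE : lambda S = s%:E by rewrite fineK// fin_num_measure.
pose N := fine (nu setT).
have NE : nu setT = N%:E by rewrite fineK// fin_num_measure.
have N0 : 0 < N.
  by rewrite -lte_fin -NE lt0e measure_ge0 andbT; exact/eqP.
have s0 : 0 < s by rewrite -lte_fin -sE.
have sAB : 4 * B * s < A.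
  by rewrite mulrC -ltr_pdivlMr ?mulr_gt0// -lte_fin -sE.
pose T := translate t K1.
have mT : measurable T := mK1t t.
pose KS := [set z.1 + z.2 | z in K1 `*` S].
have mKS : measurable KS by apply: compact_measurable_rV; exact: compact_sumset.
have KSP x y : K1 x -> K2 y -> KS (x + y) <-> S y.
  move=> Kx Ky; split=> [[[x' y'] /= [Kx' Sy'] xy]|Sy]; last by exists (x, y).
  suff -> : y = y' by [].
  apply: (packing_pair_inj Kx Kx' Ky (SK2 _ Sy')).
  by apply/eqP; rewrite subr_eq addrC addrA eq_sym subr_eq eq_sym xy addrC.
(* For [dnu] the first factor is the point mass at [t], so membership of the sum in [T] puts no
   condition on [y] in [K1]. *)
have TP x y : [set t] x -> K1 y -> T (x + y) <-> setT y.
  by move=> -> Ky; split => // _; exists y => //; rewrite addrC.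
have mt : measurable [set t].
  by apply: compact_measurable_rV; exact: compact_set1.
have dtC : dirac t (~` [set t]) = 0%E :> \bar R.
  by rewrite diracE memNset//= => /(_ erefl).
have muT : mu T = 0%E := convolution_translate_eq0 t.
have dnuTC : dnu (~` T) = 0%E := convolution_dirac_setC_translate t.
have mKST : measurable (KS `\` T) by exact: measurableD.
have dnuKST : dnu (KS `\` T) = 0%E.
  apply: (subset_measure0 mKST (measurableC mT) _ dnuTC).
  by rewrite setDE; exact: subIsetr.
have muKST : mu (KS `\` T) = (N * s)%:E.
  transitivity (mu KS).
    rewrite setDE; apply: measure_setI_full => //; first exact: measurableC.
    by rewrite setCK.
  by rewrite EFinM -NE -sE; exact: (convolution_rectangle mK1 nuK1 mK2 lambdaK2).
have dnuT : dnu T = N%:E.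
  rewrite -NE -[RHS]mul1e -(diracT R t).
  exact: (convolution_rectangle mt dtC mK1 nuK1).
set rho := measure_add _ _ in frame.
pose f := indic_fun 1 (KS `\` T).
pose g := indic_fun (2 * s) T.
(* Only [mu] contributes to the left side and only [dnu] to the right; the transform of [nu] is a
   common factor. *)
have coefs l : normc (fourier_coef rho f l) <= normc (fourier_coef rho g l).
  rewrite !fourier_coef_indic// !normcM !fourier_on_add//.
  rewrite (fourier_on_null _ mKST dnuKST) (fourier_on_null _ mT muT) addr0 add0r.
  rewrite fourier_on_setD//.
  rewrite (fourier_on_convolution l mK1 nuK1 mK2 lambdaK2 mKS mS KSP).
  rewrite (fourier_on_convolution l mt dtC mK1 nuK1 mT measurableT TP).
  rewrite !normcM normc_fourier_on_dirac mul1r.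
  have -> : normc (Complex 1 0 : R[i]) = 1.
    by rewrite /normc expr1n expr0n addr0 sqrtr1.
  have -> : normc (Complex (2 * s) 0) = 2 * s.
    by rewrite /normc expr0n addr0 sqrtr_sqr ger0_norm// mulr_ge0// ltW.
  rewrite mul1r mulrC ler_wpM2r ?sqrtr_ge0//.
  exact: normc_fourier_on_le.
have [/andP[Af _] /andP[_ gB]] :=
  (frame f (in_L2_indic _ _ mKST), frame g (in_L2_indic _ _ mT)).
have : (A%:E * sqnormL2 rho f <= B%:E * sqnormL2 rho g)%E.
  apply: le_trans Af (le_trans _ gB).
  apply: le_esum => l _; rewrite lee_fin.
  by rewrite ler_pXn2r// nnegrE sqrtr_ge0.
have -> : sqnormL2 rho f = (N * s)%:E.
  rewrite sqnormL2_indic// expr1n mul1e.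
  by rewrite [LHS]measure_addE [X in (X + _)%E]muKST [X in (_ + X)%E]dnuKST adde0.
have -> : sqnormL2 rho g = ((2 * s) ^+ 2 * N)%:E.
  rewrite sqnormL2_indic// [RHS]EFinM; congr (_ * _)%E.
  by rewrite [LHS]measure_addE [X in (X + _)%E]muT [X in (_ + X)%E]dnuT add0e.
rewrite -!EFinM lee_fin.
apply/negP; rewrite -ltNge.
(* Isolating the factor 4 B s, which is less than A, gives the strict reverse inequality. *)
have -> : B * ((2 * s) ^+ 2 * N) = (4 * B * s) * (N * s) by ring.
by rewrite ltr_pM2r// mulr_gt0.
Qed.

End packing.

Theorem theorem1p4 (R : realType) (d : nat) (K1 K2 : set 'rV[R]_d)
    (nu lambda : {finite_measure set 'rV[R]_d -> \bar R})
    (cK1 : compact K1) (cK2 : compact K2) (K12 : packing_pair K1 K2)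
    (nu_neq0 : nu [set: 'rV[R]_d] <> 0%E)
    (lambda_neq0 : lambda [set: 'rV[R]_d] <> 0%E)
    (nu_diffuse : without_atoms nu) (lambda_diffuse : without_atoms lambda)
    (nuK1 : supported_on nu K1) (lambdaK2 : supported_on lambda K2)
    (t : 'rV[R]_d) :
  let mu := convolution nu lambda in
  let rho_t := measure_add mu (convolution (dirac t) nu) in
  translationally_singular rho_t /\ ~ admits_fourier_frame rho_t.
Proof.
split.
- exact: (translationally_singular_packing cK1 cK2 K12 nuK1 lambdaK2 lambda_diffuse
    nu_neq0 lambda_neq0).
- exact: (no_fourier_frame_packing cK1 cK2 K12 nuK1 lambdaK2 lambda_diffuse
    nu_neq0 lambda_neq0).
Qed.
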